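(* Let $K$ be a field with a non-trivial valuation $v$ and let $A(x)=\sum_{i=0}^n a_ix^i\in K[x]$ be a polynomial of degree $n$. Assume that the characteristic of the residue field of $v$ does not divide $n$. If the set $\{A(x)\,g\begin{pmatrix}0&1\\1&0\end{pmatrix}: g\in U(2,K)\}$ contains an Eisenstein–Dumas polynomial at $v$, then $U(A(x))=A\big(x-\frac{a_{n-1}}{na_n}\big)$ is an Eisenstein–Dumas polynomial at $v$.
   Context: $v:K\to\Gamma\cup\{\infty\}$ is a non-trivial Krull valuation with values in a linearly ordered abelian group $\Gamma$; $K$ is not assumed henselian; the residue field is $R_v/M_v$ with $R_v=\{v\ge0\}$, $M_v=\{v>0\}$. $U(2,K)$ is the group of invertible upper triangular $2\times2$ matrices over $K$. Action: for $A$ of degree $n$, $A(x)\begin{pmatrix}a&b\\c&d\end{pmatrix}=(cx+d)^nA\big(\frac{ax+b}{cx+d}\big)$, regarded as a polynomial of formal degree $n$. A polynomial written $\sum_{i=0}^n b_ix^i$ is Eisenstein–Dumas at $v$ if (D0) $b_0b_n\neq0$; (D1) $v(b_0)-v(b_n)\notin k\Gamma=\{kg:g\in\Gamma\}$ for every integer $k>1$ dividing $n$; (D2) $nv(b_i)\ge (n-i)v(b_0)+iv(b_n)$ for $0\le i\le n$.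
   Formalization: The degree n is assumed to be at least 2; for n = 1 the claim is false (A = x+1, g = identity gives the Eisenstein–Dumas polynomial 1+x, but U(A) = x has zero constant term), and for n = 0 the coefficient a_{n-1} is undefined. *)

(* Defs.v *)
From HB Require Import structures.
From mathcomp Require Import all_boot all_order all_algebra.

Set Implicit Arguments.
Unset Strict Implicit.
Unset Printing Implicit Defensive.

Import Order.TTheory GRing.Theory Num.Theory.
Local Open Scope ring_scope.

(* [Num.POrderedZmodule] does not relate the order to the addition, and need
   not be total. *)
HB.mixin Record isOrderedAbelianGroup G of Num.POrderedZmodule G := {
  oag_le_total : total (fun x y : G => x <= y);
  oag_leD2l : forall x y z : G, x <= y -> z + x <= z + y
}.

#[short(type="oagType")]
HB.structure Definition OrderedAbelianGroup :=
  {G of isOrderedAbelianGroup G & Num.POrderedZmodule G}.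

(* [option G] stands for the disjoint union of G and {oo}; None is oo. *)
Section Infinity.
Variable G : oagType.

Definition vle (x y : option G) : bool :=
  match x, y with
  | _, None => true
  | None, Some _ => false
  | Some a, Some b => a <= b
  end.

Definition vlt (x y : option G) : bool := ~~ vle y x.

Definition vmin (x y : option G) : option G := if vle x y then x else y.

Definition vadd (x y : option G) : option G :=
  match x, y with
  | Some a, Some b => Some (a + b)
  | _, _ => None
  end.

(* Meaningful on G only: the value None is a dummy when x or y is None. *)
Definition vsub (x y : option G) : option G :=
  match x, y with
  | Some a, Some b => Some (a - b)
  | _, _ => None
  end.

Definition vmuln (k : nat) (x : option G) : option G :=
  iter k (vadd x) (Some 0).

Lemma vle_total : total vle.
Proof. by move=> [a|] [b|] //=; apply: oag_le_total. Qed.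

Lemma vle_trans : transitive vle.
Proof. by move=> [b|] [a|] [c|] //=; apply: le_trans. Qed.

Lemma vleD x y z : vle x y -> vle (vadd z x) (vadd z y).
Proof. by case: x y z => [a|] [b|] [c|] //=; apply: oag_leD2l. Qed.

Lemma vadd0 x : vadd x (Some 0) = x.
Proof. by case: x => //= a; rewrite addr0. Qed.

Lemma oag_mulr2_eq0 (a : G) : a + a = 0 -> a = 0.
Proof.
move=> a2; apply/eqP; rewrite eq_le.
have [a0|a0] := orP (oag_le_total 0 a);
  by have := oag_leD2l _ _ a a0; rewrite addr0 a2 a0 => ->.
Qed.

End Infinity.

(* The value group is allowed to be a proper subgroup of G. *)
Record valuation (K : fieldType) (G : oagType) := Valuation {
  val_fun :> K -> option G;
  val_eqoo : forall x, val_fun x = None <-> x = 0;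
  val_mul : forall x y, val_fun (x * y) = vadd (val_fun x) (val_fun y);
  val_add : forall x y, vle (vmin (val_fun x) (val_fun y)) (val_fun (x + y))
}.

Definition nontrivial_val (K : fieldType) (G : oagType) (v : valuation K G) :=
  exists2 x : K, x != 0 & v x <> Some 0.

Section ResidueField.
Variables (K : fieldType) (G : oagType) (v : valuation K G).

Lemma val0 : v 0 = None. Proof. exact/val_eqoo. Qed.

Lemma val_fin x : x != 0 -> exists a, v x = Some a.
Proof.
case E: (v x) => [a|] x0; first by exists a.
by move/val_eqoo: E => E; rewrite E eqxx in x0.
Qed.

Lemma val1 : v 1 = Some 0.
Proof.
have [a va] := val_fin (oner_neq0 K).
have := val_mul v 1 1; rewrite mulr1 va => -[] /eqP.
by rewrite -subr_eq0 opprD addrA subrr sub0r oppr_eq0 => /eqP->.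
Qed.

Lemma valN x : v (- x) = v x.
Proof.
have v_1 : v (-1) = Some 0.
  have [a va] : exists a, v (-1) = Some a.
    by apply: val_fin; rewrite oppr_eq0 oner_neq0.
  have := val_mul v (-1) (-1); rewrite mulrNN mulr1 val1 va => -[] /esym.
  by move/oag_mulr2_eq0->.
by rewrite -mulN1r val_mul v_1; case: (v x) => //= a; rewrite add0r.
Qed.

Lemma val_leD c x y : vle c (v x) -> vle c (v y) -> vle c (v (x + y)).
Proof.
move=> cx cy; apply: vle_trans (val_add v x y).
by rewrite /vmin; case: ifP.
Qed.

Lemma val_ltD c x y : vlt c (v x) -> vlt c (v y) -> vlt c (v (x + y)).
Proof.
rewrite /vlt => cx cy; apply/negP => /(vle_trans (val_add v x y)).
by rewrite /vmin; case: ifP => _; apply/negP.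
Qed.

Definition val_ring_pred : {pred K} := fun x => vle (Some 0) (v x).

Fact val_ring_subproof : subring_closed val_ring_pred.
Proof.
split; rewrite /in_mem /= /val_ring_pred.
- by rewrite val1 /= lexx.
- by move=> x y x0 y0; apply: val_leD => //; rewrite valN.
- move=> x y x0 y0; rewrite /in_mem /= val_mul.
  by apply: vle_trans x0 _; have := vleD (v x) y0; rewrite vadd0.
Qed.

HB.instance Definition _ :=
  GRing.isSubringClosed.Build K val_ring_pred val_ring_subproof.

Record val_ring := ValRing {
  val_ring_elt :> K;
  val_ring_eltP : val_ring_elt \in val_ring_pred
}.

HB.instance Definition _ := [isSub for val_ring_elt].
HB.instance Definition _ := [Choice of val_ring by <:].
HB.instance Definition _ := [SubChoice_isSubComNzRing of val_ring by <:].

Definition val_max : {pred val_ring} := fun x => vlt (Some 0) (v (val_ring_elt x)).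

Fact val_max_subproof : idealr_closed val_max.
Proof.
split; rewrite /in_mem /= /val_max.
- by rewrite (val0 : v (val_ring_elt 0) = None).
- by rewrite (val1 : v (val_ring_elt 1) = _) /vlt /= lexx.
- move=> a x y x0 y0; rewrite /in_mem /=.
  suff: vlt (Some 0) (v (val_ring_elt a * val_ring_elt x + val_ring_elt y)) by [].
  apply: val_ltD => //; apply: contra x0 => /(vle_trans _); apply.
  rewrite val_mul -[X in vle X _]vadd0 -val_mul mulrC val_mul.
  by apply: vleD; apply: val_ring_eltP.
Qed.

HB.instance Definition _ := isIdealr.Build val_ring val_max val_max_subproof.

Definition residue_field := {ideal_quot val_max}.

HB.instance Definition _ := GRing.ComNzRing.on residue_field.

Local Open Scope quotient_scope.

Lemma val_max_repr (x : residue_field) : (repr x \in val_max) = (x == 0).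
Proof.
rewrite -[in RHS](reprK x) -[0](rmorph0 \pi_residue_field).
by rewrite -(Quotient.idealrBE val_max) subr0.
Qed.

Definition residue_inv (x : residue_field) : residue_field :=
  \pi_residue_field (insubd (0 : val_ring) (val_ring_elt (repr x))^-1).

Lemma residue_mulVf (x : residue_field) : x != 0 -> residue_inv x * x = 1.
Proof.
rewrite -val_max_repr /residue_inv; set r := repr x => rM.
have vr : v (val_ring_elt r) = Some 0.
  have := val_ring_eltP r; move: rM.
  rewrite /in_mem /= /val_max /val_ring_pred /vlt negbK.
  by case: (v _) => //= a a0 a0'; congr Some; apply/eqP; rewrite eq_le a0 a0'.
have r0 : val_ring_elt r != 0 by apply/eqP => /(val_eqoo v); rewrite vr.
have rV : (val_ring_elt r)^-1 \in val_ring_pred.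
  rewrite /in_mem /= /val_ring_pred; have := val_mul v (val_ring_elt r) (val_ring_elt r)^-1.
  rewrite divff // val1 vr; case: (v _^-1) => //= a [].
  by rewrite add0r => <-.
rewrite -[X in _ * X]reprK -/r -[LHS](rmorphM \pi_residue_field).
apply: etrans (rmorph1 \pi_residue_field); congr (\pi_residue_field _).
by apply: val_inj; rewrite [LHS](rmorphM val) [X in X * _](insubdK _ rV); apply: mulVf.
Qed.

Lemma residue_invr0 : residue_inv 0 = 0.
Proof.
rewrite /residue_inv; apply: etrans (rmorph0 \pi_residue_field).
congr (\pi_residue_field _); apply: val_inj.
have : repr (0 : residue_field) \in val_max by rewrite val_max_repr.
rewrite val_insubd; case: ifP => //.
rewrite /in_mem /= /val_max /val_ring_pred; set r := val_ring_elt (repr _) => rV rM.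
have [->|r0] := eqVneq r 0; first by rewrite invr0.
have := val_mul v r r^-1; rewrite divff // val1.
move: rV rM; rewrite /vlt; case: (v r) (v r^-1) => [a|] [b|] //= b0 a0 [ab].
by move: a0; rewrite ab; have := oag_leD2l _ _ a b0; rewrite addr0 => ->.
Qed.

HB.instance Definition _ :=
  GRing.ComNzRing_isField.Build residue_field residue_mulVf residue_invr0.

End ResidueField.

Section Action.
Variable K : fieldType.

(* (c x + d)^n A((a x + b) / (c x + d)) with the denominators cleared, for
   A of formal degree n and M = (a b; c d); see [moebiusE]. *)
Definition moebius (n : nat) (A : {poly K}) (M : 'M[K]_2) : {poly K} :=
  \sum_(i < n.+1) A`_i *: ((M 0 0 *: 'X + (M 0 1)%:P) ^+ i
                           * (M 1 0 *: 'X + (M 1 1)%:P) ^+ (n - i)).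

Lemma moebiusE (n : nat) (A : {poly K}) (M : 'M[K]_2) :
  (size A <= n.+1)%N -> M \in unitmx ->
  let num : {poly K} := M 0 0 *: 'X + (M 0 1)%:P in
  let den : {poly K} := M 1 0 *: 'X + (M 1 1)%:P in
  tofrac (moebius n A M) =
    tofrac den ^+ n *
      (map_poly (fun a => tofrac a%:P) A).[tofrac num / tofrac den].
Proof.
move=> sA uM num den.
have den0 : tofrac den != 0.
  rewrite tofrac_eq0; apply: contraL uM => /eqP den0.
  rewrite unitmxE unitfE negbK (expand_det_row _ 1) !big_ord_recl big_ord0.
  have d0 : M 1 1 = 0.
    by have := congr1 (coefp 0) den0; rewrite /= !coefE mulr0 add0r.
  have c0 : M 1 0 = 0.
    by have := congr1 (coefp 1) den0; rewrite /= !coefE mulr1 addr0.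
  have -> : lift 0 0 = 1 :> 'I_2 by apply: val_inj.
  by rewrite d0 c0 !mul0r !addr0.
rewrite (horner_coef_wide _ (leq_trans (size_poly _ _) sA)) mulr_sumr.
rewrite /moebius rmorph_sum /=; apply: eq_bigr => i _.
rewrite -mul_polyC !rmorphM !rmorphXn /=.
have -> : (\poly_(j < size A) tofrac (A`_j)%:P)`_i = tofrac (A`_i)%:P.
  by rewrite coef_poly; case: ltnP => // /(nth_default 0) ->; rewrite tofrac0.
rewrite expr_div_n [RHS]mulrCA; congr (_ * _).
have -> : tofrac den ^+ n = tofrac den ^+ (n - i) * tofrac den ^+ i.
  by rewrite -exprD subnK ?leq_ord.
rewrite mulrACA.
by rewrite divff ?expf_neq0 // mulr1 mulrC.
Qed.

(* [is_trig_mx] means lower triangular, hence the transpose. *)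
Definition upper_unit : pred 'M[K]_2 :=
  fun g => (g \in unitmx) && is_trig_mx g^T.

Definition swap_mx : 'M[K]_2 := \matrix_(i, j) (i != j)%:R.

End Action.

(* The size bound says that B is written as the sum of the b_i x^i, i <= n. *)
Definition eisenstein_dumas (K : fieldType) (G : oagType) (v : valuation K G)
    (n : nat) (B : {poly K}) : Prop :=
  [/\ (size B <= n.+1)%N,
      B`_0 * B`_n != 0,
      forall k : nat, (1 < k)%N -> (k %| n)%N ->
        ~ (exists g : G, vsub (v B`_0) (v B`_n) = Some (g *+ k))
    & forall i : nat, (i <= n)%N ->
        vle (vadd (vmuln (n - i) (v B`_0)) (vmuln i (v B`_n)))
            (vmuln n (v B`_i))].

(* Main.v *)
(** Swapping [x] for [1/x] and substituting [s x] for [x] preserve the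
Eisenstein-Dumas property, so some translate [C] of [A] has it.  Let
[d = c_(n-1) / (n c_n)], where [v n = 0] by the residue characteristic
hypothesis.  Then (D2) at [n-1] gives [n v(d) >= v(c_0) - v(c_n)], and (D1) for
[k = n] makes this strict.  Hence translating [C] by [-d] keeps every
coefficient above the line of (D2) and changes [c_0] only by terms of larger
value. *)
Require Import Defs.
From mathcomp Require Import all_boot all_order all_algebra.
From mathcomp Require Import ring.
Import Order.TTheory GRing.Theory.
Set Implicit Arguments.
Unset Strict Implicit.
Unset Printing Implicit Defensive.
Local Open Scope ring_scope.

(** * Coefficients of translates, scalings and Moebius transforms *)

Section PolynomialSubstitution.
Variable K : fieldType.

(** Binomial expansion of each [(X + e)^j]. The truncated [j - i] is harmless for [j < i], since
    ['C(j, i)] is then zero. *)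
Lemma coef_comp_XaddC (p : {poly K}) (e : K) i :
  (p \Po ('X + e%:P))`_i = \sum_(j < size p) p`_j * e ^+ (j - i) *+ 'C(j, i).
Proof.
rewrite comp_polyE coef_sum; apply: eq_bigr => j _.
rewrite coefZ addrC exprDn coef_sum -mulrnAr; congr (_ * _).
under eq_bigr => k _ do rewrite coefMn -polyC_exp coefCM coefXn.
case: (ltnP i j.+1) => [lij|lji].
  rewrite (bigD1 (Ordinal lij)) //= eqxx mulr1 big1 ?addr0 // => k nk.
  by rewrite (_ : (i == k) = false) ?mulr0 ?mul0rn //; apply/eqP => ik;
     case/eqP: nk; apply: val_inj.
rewrite bin_small // mulr0n big1 // => k _.
by rewrite (_ : (i == k) = false) ?mulr0 ?mul0rn //; apply/eqP => ik;
   move: (ltn_ord k); rewrite -ik ltnNge lji.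
Qed.

Lemma coef_comp_scaleX (p : {poly K}) (s : K) i :
  (p \Po (s *: 'X))`_i = s ^+ i * p`_i.
Proof.
rewrite comp_polyE coef_sum.
under eq_bigr => j _ do rewrite exprZn !coefZ coefXn.
case: (ltnP i (size p)) => [lip|lpi].
  rewrite (bigD1 (Ordinal lip)) //= eqxx mulr1 mulrC big1 ?addr0 // => k nk.
  by rewrite (_ : (i == k) = false) ?mulr0 //; apply/eqP => ik;
     case/eqP: nk; apply: val_inj.
rewrite (nth_default _ lpi) mulr0 big1 // => k _.
by rewrite (_ : (i == k) = false) ?mulr0 //; apply/eqP => ik;
   move: (ltn_ord k); rewrite -ik ltnNge lpi.
Qed.

Lemma size_comp_XaddC (p : {poly K}) (e : K) :
  size (p \Po ('X + e%:P)) = size p.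
Proof. by rewrite size_comp_poly2 ?size_XaddC. Qed.

Lemma coef_comp_XaddC_lead (p : {poly K}) (e : K) n :
  size p = n.+1 -> (p \Po ('X + e%:P))`_n = p`_n.
Proof.
move=> sp; rewrite coef_comp_XaddC sp big_ord_recr /= subnn binn mulr1.
by rewrite big1 ?add0r // => j _; rewrite bin_small.
Qed.

(** Where [n p_n] is invertible, translation by [e] thus adds [e] to the centre [p_(n-1) / (n p_n)];
    the final comparison of centres rests on this. *)
Lemma coef_comp_XaddC_sublead (p : {poly K}) (e : K) n :
  (0 < n)%N -> size p = n.+1 ->
  (p \Po ('X + e%:P))`_n.-1 = p`_n.-1 + n%:R * p`_n * e.
Proof.
case: n => // n _ sp; rewrite coef_comp_XaddC sp !big_ord_recr /=.
rewrite big1 ?add0r => [|j _]; last by rewrite bin_small.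
by rewrite subnn binn subSn // subnn binSn; ring.
Qed.

(** The denominator is the constant [g 1 1], so the substitution is affine; writing it as a scaling
    of a translate isolates the translate to be studied. *)
Lemma moebius_upper n (A : {poly K}) (g : 'M[K]_2) :
  (size A <= n.+1)%N -> g 1 0 = 0 -> g 1 1 != 0 ->
  moebius n A g =
    g 1 1 ^+ n *: ((A \Po ('X + (g 0 1 / g 1 1)%:P))
                     \Po ((g 0 0 / g 1 1) *: 'X)).
Proof.
move=> sA c0 d0; rewrite -comp_polyA comp_polyD comp_polyX comp_polyC.
rewrite comp_polyE /moebius c0.
rewrite (big_ord_widen n.+1 (fun i => A`_i *: (_ + _) ^+ i) sA).
rewrite [in RHS]big_mkcond scaler_sumr; apply: eq_bigr => i _.
case: ifP => [_|/negbT]; last first.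
  by rewrite -leqNgt => /(nth_default 0) ->; rewrite !scale0r scaler0.
have -> : g 0 0 *: 'X + (g 0 1)%:P =
    g 1 1 *: ((g 0 0 / g 1 1) *: 'X + (g 0 1 / g 1 1)%:P) :> {poly K}.
  by rewrite scalerDr scalerA -!mul_polyC -polyCM !(mulrC (g 1 1)) !divfK.
rewrite exprZn scale0r add0r -polyC_exp mulrC mul_polyC !scalerA.
by congr (_ *: _); rewrite -mulrA -exprD subnK ?leq_ord // mulrC.
Qed.

Lemma coef_moebius_swap n (B : {poly K}) i :
  (i <= n)%N -> (moebius n B (swap_mx K))`_i = B`_(n - i).
Proof.
move=> lin; rewrite /moebius coef_sum.
have lni : (n - i < n.+1)%N by rewrite ltnS leq_subr.
rewrite (bigD1 (Ordinal lni)) //= big1 => [|j nj].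
  rewrite addr0 !mxE /= scale0r add0r expr1n mul1r scale1r addr0 coefZ coefXn.
  by rewrite subKn // eqxx mulr1.
rewrite !mxE /= scale0r add0r expr1n mul1r scale1r addr0 coefZ coefXn.
rewrite (_ : (i == _) = false) ?mulr0 //; apply/eqP => ij; case/eqP: nj.
by apply: val_inj; rewrite /= ij subKn // -ltnS.
Qed.

End PolynomialSubstitution.

(** * Comparing elements of [K] by their values *)

Section ValuationOrder.
Variables (K : fieldType) (G : oagType) (v : valuation K G).
Implicit Types x y z t : K.

Local Notation "x <=v y" := (vle (v x) (v y)) (at level 70).
Local Notation "x <v y" := (vlt (v x) (v y)) (at level 70).

Lemma vmuln_Some k (g : G) : vmuln k (Some g) = Some (g *+ k).
Proof.
elim: k => [|k IH]; first by rewrite mulr0n.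
by rewrite /vmuln iterS -/(vmuln _ _) IH mulrS.
Qed.

Lemma val_expr k x : v (x ^+ k) = vmuln k (v x).
Proof.
elim: k => [|k IH]; first exact: Defs.val1.
by rewrite exprS val_mul IH.
Qed.

Lemma vle_refl (a : option G) : vle a a.
Proof. by case: a => //= a; apply: lexx. Qed.

Lemma vle_anti (a b : option G) : vle a b -> vle b a -> a = b.
Proof.
case: a b => [a|] [b|] //= ab ba; congr Some.
by apply/eqP; rewrite eq_le ab ba.
Qed.

Lemma vltW (a b : option G) : vlt a b -> vle a b.
Proof. by have := vle_total a b; rewrite /vlt; case: (vle a b); case: (vle b a). Qed.

Lemma val_leM2l z x y : x <=v y -> z * x <=v z * y.
Proof. by rewrite !val_mul; apply: vleD. Qed.

Lemma val_leM x y z t : x <=v y -> z <=v t -> x * z <=v y * t.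
Proof.
move=> xy zt; apply: vle_trans _ (val_leM2l y zt).
by rewrite ![_ * z]mulrC; apply: val_leM2l.
Qed.

Lemma val_leX k x y : x <=v y -> x ^+ k <=v y ^+ k.
Proof.
by move=> xy; elim: k => [|k IH]; rewrite ?vle_refl // !exprS val_leM.
Qed.

Lemma val_leM2l_cancel z x y : z != 0 -> z * x <=v z * y -> x <=v y.
Proof. by move=> z0 /(val_leM2l z^-1); rewrite !mulKf. Qed.

Lemma val_ltM x y z t : x != 0 -> x <=v y -> z <v t -> x * z <v y * t.
Proof.
move=> x0 xy; apply: contra => ytxz; apply: (val_leM2l_cancel x0).
by apply: vle_trans ytxz; rewrite ![_ * t]mulrC; apply: val_leM2l.
Qed.

Lemma val_ltX k x y : (0 < k)%N -> x != 0 -> x <v y -> x ^+ k <v y ^+ k.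
Proof.
case: k => // k _ x0 xy; rewrite !exprSr; apply: val_ltM => //.
  by rewrite expf_neq0.
by apply/val_leX/vltW.
Qed.

(** An empty sum has infinite value, so [v x] has to be finite. *)
Lemma val_lt_sum (I : finType) (P : pred I) (F : I -> K) x :
  x != 0 ->
  (forall i, P i -> x <v F i) -> x <v \sum_(i | P i) F i.
Proof.
move=> x0 cF; elim/big_ind: _ => // [|y z]; last exact: val_ltD.
by rewrite /vlt val0; have [a ->] := val_fin v x0.
Qed.

(** Otherwise [x = (x + y) - y] would be a difference of two elements of value larger than [v x]. *)
Lemma valD_dominant x y : x <v y -> v (x + y) = v x.
Proof.
move=> xy; apply/esym/vle_anti; first by apply: val_leD; rewrite ?vle_refl ?vltW.
rewrite -[vle _ _]negbK; apply/negP => xxy.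
have : x <v (x + y) - y by apply: val_ltD; rewrite ?valN.
by rewrite addrK /vlt vle_refl.
Qed.

Lemma val_natr m : vle (Some 0) (v m%:R).
Proof.
elim: m => [|m IH]; first by rewrite val0.
by rewrite -natr1; apply: val_leD => //; rewrite Defs.val1 vle_refl.
Qed.

Local Open Scope quotient_scope.

(** If [n] had positive value it would vanish in the residue field, whose characteristic would then
    be a prime factor of [n]. *)
Lemma val_natr_unit n : (0 < n)%N ->
  (forall p : nat, p \in [pchar (residue_field v)] -> ~~ (p %| n)%N) ->
  v n%:R = Some 0.
Proof.
move=> n_gt0 chn; apply: vle_anti (val_natr n); rewrite -[vle _ _]negbK.
apply/negP => n_max.
have n0 : n%:R = 0 :> residue_field v.
  have -> : n%:R = \pi_(residue_field v) (n%:R : val_ring v).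
    exact: esym (rmorph_nat \pi_(residue_field v) n).
  apply/eqP; rewrite -[0](rmorph0 \pi_(residue_field v)).
  rewrite -(Quotient.idealrBE (@val_max _ _ v)) subr0.
  by rewrite /in_mem /= /val_max [val_ring_elt _](rmorph_nat val).
have [p chp] := natf0_pchar n_gt0 (introT eqP n0).
by have := chn p chp; rewrite (dvdn_pcharf chp) n0 eqxx.
Qed.

(** Puts (D2) into the form of a comparison between elements of [K], so that ring identities replace
    computations with values. *)
Lemma ed_lineE a b n x y z :
  vle (vadd (vmuln a (v x)) (vmuln b (v y))) (vmuln n (v z))
  = (x ^+ a * y ^+ b <=v z ^+ n).
Proof. by rewrite val_mul !val_expr. Qed.

End ValuationOrder.

(** * The Eisenstein-Dumas conditions under swap, scaling and translation *)

Section EisensteinDumas.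
Variables (K : fieldType) (G : oagType) (v : valuation K G).

Local Notation "x <=v y" := (vle (v x) (v y)) (at level 70).
Local Notation "x <v y" := (vlt (v x) (v y)) (at level 70).

(** Reversing the coefficients negates [v b_0 - v b_n], which respects the multiples of [k], and
    exchanges (D2) at [i] with (D2) at [n - i]. *)
Lemma eisenstein_dumas_swap n (B : {poly K}) :
  (size B <= n.+1)%N ->
  eisenstein_dumas v n (moebius n B (swap_mx K)) -> eisenstein_dumas v n B.
Proof.
move=> sB [_]; rewrite !coef_moebius_swap ?subnn ?subn0 // => nz0 D1 D2.
split=> // [|k k1 kn [g Bg]|i lin]; first by rewrite mulrC.
  apply: (D1 k k1 kn); exists (- g); move: Bg.
  case: (v B`_0) (v B`_n) => [a|] [b|] //= [ab]; congr Some.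
  by rewrite mulNrn -ab opprB.
have := D2 (n - i)%N (leq_subr i n).
by rewrite coef_moebius_swap ?leq_subr // subKn // !ed_lineE mulrC.
Qed.

(** Each [c_i] becomes [d s^i c_i], which adds the same amount [n v(d) + i n v(s)] to both sides of
    (D2). *)
Lemma eisenstein_dumas_scale n (C : {poly K}) (d s : K) :
  (size C <= n.+1)%N -> d != 0 -> s != 0 ->
  eisenstein_dumas v n (d *: (C \Po (s *: 'X))) -> eisenstein_dumas v n C.
Proof.
move=> sC d0 s0 [_]; rewrite !coefZ !coef_comp_scaleX expr0 mul1r => nz0 D1 D2.
split=> //; first by apply: contraNneq nz0 => /eqP;
  rewrite mulf_eq0 => /orP[]/eqP->; rewrite !(mulr0, mul0r).
  move=> k k1 kn [g Cg]; apply: (D1 k k1 kn).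
  have [h vs] := val_fin v s0; have [e vd] := val_fin v d0.
  have vsn : v (s ^+ n) = Some (h *+ n) by rewrite val_expr vs vmuln_Some.
  (* Scaling lowers [v c_0 - v c_n] by [n v(s)], a multiple of [k] because [k] divides [n]. *)
  exists (g - h *+ (n %/ k)); move: Cg; rewrite !val_mul vsn vd.
  case: (v C`_0) (v C`_n) => [a|] [b|] //= [ab]; congr Some.
  rewrite mulrnBl -mulrnA divnK // -ab !opprD addrACA subrr add0r.
  by rewrite addrCA addrC -addrA addrC addrAC.
move=> i lin; have := D2 i lin.
rewrite !ed_lineE !coefZ !coef_comp_scaleX.
rewrite (_ : (d * C`_0) ^+ _ * _ =
  (d ^+ n * s ^+ (i * n)) * (C`_0 ^+ (n - i) * C`_n ^+ i)); last first.
  have -> : d ^+ n = d ^+ (n - i) * d ^+ i by rewrite -exprD subnK.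
  by rewrite !exprMn -exprM (mulnC n i); ring.
rewrite (_ : (d * _) ^+ n = (d ^+ n * s ^+ (i * n)) * C`_i ^+ n); last first.
  by rewrite !exprMn -exprM mulrA.
by apply: val_leM2l_cancel; rewrite mulf_neq0 ?expf_neq0.
Qed.

Lemma eisenstein_dumas_sublead n (C : {poly K}) :
  (1 < n)%N -> v n%:R = Some 0 -> eisenstein_dumas v n C ->
  C`_0 <v (C`_n * (C`_n.-1 / (n%:R * C`_n)) ^+ n).
Proof.
move=> n_gt1 vn [_ nz0 D1 D2]; have n_gt0 := ltnW n_gt1.
have cn0 : C`_n != 0 by apply: contraNneq nz0 => ->; rewrite mulr0.
have n0 : n%:R != 0 :> K by apply/eqP => /(val_eqoo v); rewrite vn.
set d := _ / _.
have cd : C`_n.-1 = n%:R * C`_n * d.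
  by rewrite /d mulrCA divff ?mulr1 // mulf_neq0.
have le : C`_0 <=v C`_n * d ^+ n.
  have := D2 n.-1 (leq_pred n).
  rewrite ed_lineE -subn1 subKn // subn1 expr1 cd !exprMn.
  have -> : C`_n ^+ n = C`_n ^+ n.-1 * C`_n by rewrite -exprSr prednK.
  rewrite mulrC => h.
  apply: (val_leM2l_cancel (expf_neq0 n.-1 cn0)).
  have vnn : v (n%:R ^+ n) = Some 0 by rewrite val_expr vn vmuln_Some mul0rn.
  apply: vle_trans h _; rewrite -!mulrA [v (n%:R ^+ n * _)]val_mul vnn.
  by case: (v _) => //= a; rewrite add0r lexx.
(* Equality would give [v c_0 - v c_n = n v(d)], against (D1); if [d = 0], the right-hand value is
   infinite and equality is impossible. *)
rewrite /vlt; apply/negP => ge; apply: (D1 n n_gt1 (dvdnn n)).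
have := vle_anti le ge; rewrite val_mul val_expr.
have c00 : C`_0 != 0 by apply: contraNneq nz0 => ->; rewrite mul0r.
have [a ->] := val_fin v c00; have [b ->] := val_fin v cn0.
case: (v d) => [g|]; last by case: (n) n_gt0.
rewrite vmuln_Some.
by case=> ->; exists g; rewrite /= addrC addKr.
Qed.

Lemma eisenstein_dumas_translate n (C : {poly K}) :
  (1 < n)%N -> v n%:R = Some 0 -> eisenstein_dumas v n C ->
  eisenstein_dumas v n (C \Po ('X + (- (C`_n.-1 / (n%:R * C`_n)))%:P)).
Proof.
move=> n_gt1 vn edC; have := eisenstein_dumas_sublead n_gt1 vn edC.
move: edC => [sC nz0 D1 D2]; set d := _ / _ => lt_d.
have cn0 : C`_n != 0 by apply: contraNneq nz0 => ->; rewrite mulr0.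
have c00 : C`_0 != 0 by apply: contraNneq nz0 => ->; rewrite mul0r.
have sCn : size C = n.+1.
  by apply/eqP; rewrite eqn_leq sC ltnNge; apply: contra cn0 => /(nth_default 0)->.
have lt_dN : C`_0 <v C`_n * (- d) ^+ n.
  by move: lt_d; rewrite !val_mul !val_expr valN.
set e := - d in lt_dN *.
have en : (C \Po ('X + e%:P))`_n = C`_n by apply: coef_comp_XaddC_lead.
have e0 : v (C \Po ('X + e%:P))`_0 = v C`_0.
  rewrite coef_comp_XaddC sCn big_ord_recl /= subnn expr0 bin0 mulr1 mulr1n.
  apply: valD_dominant; apply: val_lt_sum => // j _.
  rewrite /bump add1n subn0 bin0 mulr1n; set m := j.+1.
  have lmn : (m <= n)%N by exact: ltn_ord.
  have := D2 m lmn; rewrite ed_lineE => D2m.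
  (* Multiply (D2) at [m] by the [m]-th power of [lt_dN]; cancelling [c_n^m] leaves [c_0^n] of
     smaller value than [(c_m e^m)^n]. *)
  have : C`_0 ^+ (n - m) * C`_n ^+ m * C`_0 ^+ m
           <v C`_m ^+ n * (C`_n * e ^+ n) ^+ m.
    by apply: val_ltM; rewrite ?mulf_neq0 ?expf_neq0 // val_ltX.
  apply: contra => /(val_leX n) /(val_leM2l (C`_n ^+ m)).
  rewrite !exprMn -!exprM (mulnC n m) mulrCA => /vle_trans; apply.
  by rewrite mulrAC -exprD subnK // mulrC vle_refl.
split; rewrite ?size_comp_XaddC //.
- rewrite en mulf_neq0 //; apply/eqP => /(val_eqoo v); rewrite e0.
  by have [a ->] := val_fin v c00.
- by move=> k k1 kn; rewrite e0 en; apply: D1.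
move=> i lin; rewrite e0 en ed_lineE coef_comp_XaddC sCn.
(* The lower bound on [v (x^n)] is stable under sums, as [v (x + y)] is at least the smaller of
   [v x] and [v y]; each term can be bounded separately. *)
apply: (@big_ind _ (fun x => vle _ (v (x ^+ n)))).
- rewrite expr0n; case: (n) n_gt1 => // m _; rewrite val0.
  by case: (v _).
- move=> x y; have [xy|/vltW yx] := boolP (x <=v y).
    move=> lx _; apply: vle_trans lx (val_leX n _).
    by apply: val_leD; rewrite ?vle_refl.
  move=> _ ly; apply: vle_trans ly (val_leX n _).
  by apply: val_leD; rewrite ?vle_refl.
move=> [j ljn] _ /=.
have [lij|lji] := leqP i j; last first.
  rewrite bin_small // mulr0n expr0n; case: (n) n_gt1 => // m _; rewrite val0.
  by case: (v _).
have := D2 j ljn; rewrite ed_lineE => D2j.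
(* With the extra factor [c_n^(j-i)], the claim is the product of (D2) at [j], the [(j - i)]-th
   power of [lt_dN], and the nonnegative value of a binomial coefficient. *)
apply: (val_leM2l_cancel (expf_neq0 (j - i) cn0)).
have h1 : C`_0 ^+ (n - j) * C`_n ^+ j * C`_0 ^+ (j - i)
           <=v C`_j ^+ n * (C`_n * e ^+ n) ^+ (j - i).
  by apply: val_leM => //; apply/val_leX/vltW.
have h2 : 1 <=v ('C(j, i)%:R ^+ n : K).
  by rewrite -{1}(expr1n _ n); apply: val_leX; rewrite Defs.val1 val_natr.
have := val_leM h1 h2; rewrite mulr1.
congr (vle (v _) (v _)).
  rewrite mulrAC -exprD addnBA // subnK //.
  by rewrite [RHS]mulrCA -exprD subnK.
rewrite -[X in _ = _ * X ^+ _]mulr_natr !exprMn -!exprM (mulnC n (j - i)%N).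
by ring.
Qed.

End EisensteinDumas.

(** * Reduction to a translate of [A], and its recentring *)

Theorem theorem2p7 (K : fieldType) (G : oagType) (v : valuation K G)
  (n : nat) (A : {poly K}) :
  nontrivial_val v ->
  (1 < n)%N ->
  size A = n.+1 ->
  (forall p : nat, p \in [pchar (residue_field v)] -> ~~ (p %| n)%N) ->
  (exists2 g : 'M[K]_2, upper_unit g
     & eisenstein_dumas v n (moebius n (moebius n A g) (swap_mx K))) ->
  eisenstein_dumas v n (A \Po ('X - (A`_n.-1 / (n%:R * A`_n))%:P)).
Proof.
move=> _ n_gt1 sA chn [g /andP[ug tg] ed].
have n_gt0 := ltnW n_gt1.
have vn := val_natr_unit n_gt0 chn.
have g10 : g 1 0 = 0 by have /is_trig_mxP/(_ 0 1 isT) := tg; rewrite mxE.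
have [a0 d0] : g 0 0 != 0 /\ g 1 1 != 0.
  move: ug; rewrite unitmxE unitfE -det_tr det_trig // => /prodf_neq0 dg.
  by have := (dg 0 isT, dg 1 isT); rewrite !mxE => -[].
set u := g 0 1 / g 1 1; set C := A \Po ('X + u%:P).
have sC : size C = n.+1 by rewrite size_comp_XaddC.
(* The swap and the diagonal part of [g] are undone, leaving the translate by [u]. *)
have edC : eisenstein_dumas v n C.
  apply: (@eisenstein_dumas_scale _ _ v n C (g 1 1 ^+ n) (g 0 0 / g 1 1)).
  - by rewrite sC.
  - by rewrite expf_neq0.
  - by rewrite mulf_neq0 ?invr_eq0.
  rewrite -moebius_upper ?sA //; apply: eisenstein_dumas_swap => //.
  rewrite moebius_upper ?sA //; apply: leq_trans (size_scale_leq _ _) _.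
  rewrite size_comp_poly2 ?sC // size_scale ?size_polyX //.
  by rewrite mulf_neq0 ?invr_eq0.
have n0 : n%:R != 0 :> K by apply/eqP => /(val_eqoo v); rewrite vn.
have an0 : A`_n != 0.
  by have := lead_coef_eq0 A; rewrite lead_coefE sA -size_poly_eq0 sA => ->.
have := eisenstein_dumas_translate n_gt1 vn edC.
rewrite {2 3}/C coef_comp_XaddC_lead // coef_comp_XaddC_sublead //.
congr (eisenstein_dumas v n _).
(* The centre of [C] is that of [A] plus [u], so the two successive translations compose to the one
   by minus the centre of [A]. *)
rewrite -comp_polyA comp_polyD comp_polyX comp_polyC -addrA -polyCD.
congr (A \Po (_ + _)); rewrite -polyCN; congr (_%:P).
by field; rewrite n0 an0.
Qed.
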